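(* Let $\mathcal{H}=\{\chi_{[0,t]} : t\in[0,1]\}\subset L^2([0,1])$. Then there are constants $C_1,C_2>0$ such that for all sufficiently small $\varepsilon>0$ $$C_1\Big(\frac1\varepsilon\Big)^2\le M(\varepsilon,\mathcal{H})\le C_2\Big(\frac1\varepsilon\Big)^2,$$ and $$\lim_{\varepsilon\to0^+}\frac{H(\varepsilon,\mathcal{H})}{2\log(1/\varepsilon)}=1 .$$
   Context: $\chi_E$ denotes the characteristic function of $E$. For a relatively compact subset $A$ of a metric space $X$ and $\varepsilon>0$, the covering number $M(\varepsilon,A)$ is the minimal number of closed $\varepsilon$-balls in $X$ covering $A$, and the $\varepsilon$-entropy of $A$ is $H(\varepsilon,A)=\log M(\varepsilon,A)$, where $\log$ is the binary logarithm. Here $X=L^2([0,1])$ with the metric given by its norm. *)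

(* Defs.v *)
From HB Require Import structures.
From mathcomp Require Import all_boot all_order all_algebra.
From mathcomp Require Import all_classical all_reals all_analysis.
From mathcomp Require Import measurable_realfun ess_sup_inf.

Set Implicit Arguments.
Unset Strict Implicit.
Unset Printing Implicit Defensive.

Import Order.TTheory GRing.Theory Num.Theory.
Import numFieldNormedType.Exports.

Local Open Scope classical_set_scope.
Local Open Scope ring_scope.

Section covering_number.
Context {R : realType} {X : metricType R}.
Implicit Types (e : R) (A : set X) (n : nat).

(* In a general metric space the library's [closed_ball], the closure of the
   open ball, can be smaller than this set. *)
Definition metric_closed_ball (x : X) e : set X := [set y | mdist x y <= e].

(* The centres are arbitrary points of [X], not necessarily in [A]. *)
Definition covered_by e A n :=
  exists c : 'I_n -> X, A `<=` \bigcup_(i in [set: 'I_n]) metric_closed_ball (c i) e.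

(* If [A] has no finite cover, [get] returns the default value [0]. *)
Definition covering_number e A : nat :=
  [get n | covered_by e A n /\ forall m, covered_by e A m -> (n <= m)%N].

Lemma covering_numberP e A : (exists n, covered_by e A n) ->
  covered_by e A (covering_number e A) /\
  forall m, covered_by e A m -> (covering_number e A <= m)%N.
Proof.
move=> [n cn].
have exP : exists n, `[< covered_by e A n >] by exists n; exact/asboolP.
apply: (@getPex _ [set n | covered_by e A n /\
  forall m, covered_by e A m -> (n <= m)%N]).
case: (ex_minnP exP) => k /asboolP ck kmin.
by exists k; split => // m /asboolP; exact: kmin.
Qed.

Definition log2 (x : R) : R := ln x / ln 2.

Definition entropy e A : R := log2 (covering_number e A)%:R.

End covering_number.

Lemma ae_eq_Lnorm d (T : measurableType d) (R : realType)
    (mu : {measure set T -> \bar R}) (p : \bar R) (f g : T -> R) :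
  measurable_fun [set: T] f -> measurable_fun [set: T] g ->
  (\forall x \ae mu, f x = g x) ->
  ('N[mu]_p[EFin \o f] = 'N[mu]_p[EFin \o g])%E.
Proof.
move=> mf mg fg; rewrite unlock /Lnorm; case: p => [r||].
- congr poweR; apply: ge0_ae_eq_integral => //.
  + apply: (measurableT_comp (measurable_poweR r)).
    by apply: measurableT_comp => //; exact/measurable_EFinP.
  + apply: (measurableT_comp (measurable_poweR r)).
    by apply: measurableT_comp => //; exact/measurable_EFinP.
  + by move=> x _; exact: poweR_ge0.
  + by move=> x _; exact: poweR_ge0.
  + by apply: filterS fg => x /= ->.
- by case: ifP => // _; apply: eq_ess_sup; apply: filterS fg => x /= ->.
- by case: ifP => // _; apply: eq_ess_inf; apply: filterS fg => x /= ->.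
Qed.

Section Lspace_metric.
Context d (T : measurableType d) (R : realType).
Variables (mu : {measure set T -> \bar R}) (p : \bar R) (p1 : (1 <= p)%E).
Local Notation L := (LspaceType mu p1).

HB.instance Definition _ := gen_eqMixin L.
HB.instance Definition _ := gen_choiceMixin L.

Lemma measurable_Lspace (f : L) : measurable_fun [set: T] (f : T -> R).
Proof. exact: (measurable_funPT (repr (f : {mfun_ mu, T >-> measurableTypeR R}))). Qed.

Lemma Lspace_aeP (f g : L) : (\forall x \ae mu, (f : T -> R) x = (g : T -> R) x) -> f = g.
Proof.
case: f => f [[nf]]; case: g => g [[ng]] /= fg.
have {}fg : f = g.
  rewrite -[f]reprK -[g]reprK; apply/eqP; rewrite eqmodE; apply/asboolP.
  by apply: filterS fg => x fgx _.
by subst g; rewrite (Prop_irrelevance nf ng).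
Qed.

Let dist (f g : L) : R :=
  fine ('N[mu]_p[EFin \o ((f : T -> R) \- (g : T -> R))%R])%E.

Let distE (f g : L) :
  (dist f g)%:E = ('N[mu]_p[EFin \o ((f : T -> R) \- (g : T -> R))%R])%E.
Proof.
rewrite fineK// ge0_fin_numE ?Lnorm_ge0//.
have -> : EFin \o ((f : T -> R) \- (g : T -> R)) =
    EFin \o ((f : T -> R) \+ (\- (g : T -> R))) by [].
apply: (le_lt_trans (eminkowski _ _ _ p1)).
- exact: measurable_Lspace.
- exact: measurableT_comp (measurable_Lspace g).
rewrite lte_add_pinfty//; first exact: Lebesgue_finite.
have -> : EFin \o (\- (g : T -> R)) = (\- (EFin \o (g : T -> R)))%E by [].
by rewrite oppe_Lnorm; exact: Lebesgue_finite.
Qed.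

Let distxx f : dist f f = 0.
Proof.
rewrite /dist (_ : _ \o _ = cst 0%E).
  by rewrite Lnorm0// gt_eqF// (lt_le_trans lte01 p1).
by apply/funext => x /=; rewrite subrr.
Qed.

Let dist_positivity f g : dist f g = 0 -> f = g.
Proof.
move=> fg0; apply: Lspace_aeP.
have /measurable_EFinP mfg :
    measurable_fun [set: T] ((f : T -> R) \- (g : T -> R)).
  by apply: measurable_funB; exact: measurable_Lspace.
have := distE f g; rewrite fg0 => /esym.
move=> /(Lnorm_eq0_eq0 mfg (lt_le_trans lte01 p1)).
by apply: filterS => x /(_ I)[] /eqP; rewrite subr_eq0 => /eqP.
Qed.

Let dist_sym f g : dist f g = dist g f.
Proof.
rewrite /dist -oppe_Lnorm; congr (fine (Lnorm _ _ _)).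
by apply/funext => x /=; rewrite opprB.
Qed.

Let dist_triangle g f h : dist f h <= dist f g + dist g h.
Proof.
rewrite -lee_fin EFinD !distE.
rewrite (_ : (f : T -> R) \- (h : T -> R) =
  ((f : T -> R) \- (g : T -> R)) \+ ((g : T -> R) \- (h : T -> R))); last first.
  by apply/funext => x /=; rewrite addrA subrK.
by apply: eminkowski => //; apply: measurable_funB; exact: measurable_Lspace.
Qed.

HB.instance Definition _ := isMetric.Build R L
  distxx dist_positivity dist_sym dist_triangle.

Lemma Lspace_mdistE (f g : L) :
  (mdist f g)%:E = ('N[mu]_p[EFin \o ((f : T -> R) \- (g : T -> R))%R])%E.
Proof. exact: distE. Qed.

(* [LspaceType] is built over the codomain [measurableTypeR R], [LfunType] over
   the (unfolded) Borel structure of [R]. *)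
Definition Lfun_mfun (f : LfunType mu p1) : T -> measurableTypeR R := f.

Lemma measurable_Lfun_mfun f : measurable_fun [set: T] (Lfun_mfun f).
Proof. exact: (@measurable_funPT _ _ _ _ f). Qed.

HB.instance Definition _ f :=
  isMeasurableFun.Build _ _ _ _ (Lfun_mfun f) (measurable_Lfun_mfun f).

Definition Lspace_pi (f : LfunType mu p1) : {mfun_ mu, T >-> measurableTypeR R} :=
  (\pi_({mfun_ mu, T >-> measurableTypeR R}) (Lfun_mfun f))%qT.

Lemma Lspace_pi_ae (f : LfunType mu p1) :
  \forall x \ae mu, (Lspace_pi f : T -> R) x = f x.
Proof.
have : ae_eq_op mu (repr (Lspace_pi f)) (Lfun_mfun f).
  by rewrite -eqmodE reprK.
by move/asboolP; apply: filterS => x /(_ I).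
Qed.

Lemma Lspace_pi_finite (f : LfunType mu p1) :
  finite_norm mu p (Lspace_pi f : T -> R).
Proof.
have := Lfunction_finite p1 f; rewrite /finite_norm.
rewrite (ae_eq_Lnorm p _ _ (Lspace_pi_ae f))//.
exact: (measurable_funPT (repr (Lspace_pi f))).
Qed.

HB.instance Definition _ (f : LfunType mu p1) :=
  isFinLebesgue.Build d T R mu p p1 (Lspace_pi f) (Lspace_pi_finite f).

Definition Lspace_class (f : LfunType mu p1) : L := Lspace_pi f.

Lemma Lspace_class_ae (f : LfunType mu p1) :
  \forall x \ae mu, (Lspace_class f : T -> R) x = f x.
Proof. exact: Lspace_pi_ae. Qed.

End Lspace_metric.

Section characteristic_functions.
Context (R : realType).

Definition lebesgue01 := mrestr (@lebesgue_measure R) (measurable_itv `[0, 1]).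
HB.instance Definition _ := Measure.on lebesgue01.

(* Real-valued square-integrable Borel functions on the line, identified when
   they agree almost everywhere on [[0, 1]]. *)
Definition L2_01 := LspaceType2 lebesgue01.

Definition char_fun (t : R) : measurableTypeR R -> R := \1_`[0, t].

Lemma measurable_char_fun t : measurable_fun [set: measurableTypeR R] (char_fun t).
Proof. exact: measurable_indic. Qed.

Lemma char_fun_finite t : finite_norm lebesgue01 2%:R%:E (char_fun t).
Proof.
rewrite /finite_norm unlock /Lnorm poweR_lty//.
apply: (@le_lt_trans _ _ (\int[lebesgue01]_x cst 1 x)%E).
  apply: ge0_le_integral => //.
  - by move=> x _; exact: poweR_ge0.
  - apply: (measurableT_comp (measurable_poweR _)).
    apply: measurableT_comp => //; apply/measurable_EFinP.
    exact: measurable_char_fun.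
  - move=> x _ /=; rewrite /char_fun indicE.
    by case: (_ \in _); rewrite ?normr1 ?normr0 ?powR1 ?powR0// lee_fin.
rewrite integral_cst// mul1e.
rewrite [X in (X < _)%E](_ : _ = lebesgue_measure (`[0, 1] : set R)); last first.
  exact: (congr1 lebesgue_measure (setTI _)).
by rewrite lebesgue_measure_itv/= lte_fin ltr01 sube0 ltry.
Qed.

HB.instance Definition _ t :=
  isMeasurableFun.Build _ _ _ _ (char_fun t) (measurable_char_fun t).
HB.instance Definition _ t :=
  isLfunction.Build _ _ _ lebesgue01 2%:R%:E (lee1n 2) (char_fun t)
    (char_fun_finite t).

Definition char_class (t : R) : L2_01 :=
  Lspace_class (char_fun t : LfunType lebesgue01 (lee1n 2)).

Definition char_intervals : set L2_01 := [set char_class t | t in `[0, 1]].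

End characteristic_functions.
Arguments char_intervals : clear implicits.

(* Main.v *)
Require Import Defs.
From mathcomp Require Import all_boot all_order all_algebra.
From mathcomp Require Import all_classical all_reals all_analysis.
From mathcomp Require Import measurable_realfun ring lra.

Import Order.TTheory GRing.Theory Num.Theory.
Import numFieldNormedType.Exports.

Local Open Scope classical_set_scope.
Local Open Scope ring_scope.

(** For [s] and [t] in [[0, 1]] the functions [char_fun s] and [char_fun t]
    differ by the indicator of the interval between [s] and [t], so that their
    distance in L^2 is the square root of [`|s - t|] ([mdist_char_class]).  The
    family of characteristic functions is thus [[0, 1]] with the metric
    [sqrt `|s - t|], and balls of radius [e] amount to intervals of length of
    order [e ^+ 2].

    Upper bound ([char_covered]): if [n >= (1 / e) ^+ 2], every [t] lies within
    [1 / n <= e ^+ 2] of some [i / n] with [i < n], so [n] balls suffice; the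
    least such [n] is at most [2 * (1 / e) ^+ 2] when [e <= 1].

    Lower bound ([char_covered_ge]): if [n < 4^-1 * (1 / e) ^+ 2], the [n + 1]
    points [j / n] are at distance more than [2 * e] from each other, and a ball
    of radius [e] contains at most one of them ([packing_le_cover]); hence [n]
    balls cannot cover.

    Taking logarithms, the entropy is [2 * log2 (1 / e)] up to a bounded term,
    and [log2 (1 / e)] tends to infinity, which gives the limit
    ([cvg_log2_div_log2]). *)

Lemma char_fun_sub (R : realType) (s t : R) : 0 <= s -> s <= t ->
  char_fun t \- char_fun s = \1_`]s, t] :> (R -> R).
Proof.
move=> s0 st; apply/funext => x /=; rewrite /char_fun !indicE !mem_setE !in_itv/=.
have [xs|sx] := leP x s; first by rewrite (le_trans xs st) subrr.
by rewrite (le_trans s0 (ltW sx))/= subr0.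
Qed.

Lemma Lnorm2_indic d (T : measurableType d) (R : realType)
    (mu : {measure set T -> \bar R}) (A : set T) : measurable A ->
  ('N[mu]_2%:R%:E[EFin \o (\1_A : T -> R)] = mu A `^ 2^-1)%E.
Proof.
move=> mA; rewrite unlock /Lnorm; congr poweR.
rewrite (eq_integral (fun x => (\1_A x)%:E)); first by rewrite integral_indic// setIT.
move=> x _ /=; rewrite indicE.
by case: (_ \in _); rewrite ?normr1 ?normr0 ?powR1 ?powR0.
Qed.

Lemma mdist_char_class (R : realType) (s t : R) :
  0 <= s <= 1 -> 0 <= t <= 1 ->
  mdist (char_class s) (char_class t) = Num.sqrt `|s - t|.
Proof.
wlog st : s t / s <= t.
  move=> H hs ht; have [|/ltW ts] := leP s t; first by move=> st; exact: H.
  by rewrite metric_sym distrC H.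
move=> /andP[s0 s1] /andP[t0 t1]; rewrite metric_sym; apply: EFin_inj.
rewrite Lspace_mdistE.
rewrite (@ae_eq_Lnorm _ _ _ _ _ _ (char_fun t \- char_fun s)).
- rewrite char_fun_sub// Lnorm2_indic//.
  rewrite [X in poweR X _](_ : _ = (t - s)%:E); last first.
    rewrite [LHS](_ : _ = lebesgue_measure (`]s, t]%classic : set R)); last first.
      apply: (congr1 lebesgue_measure); apply: setIidl => x /=.
      rewrite !in_itv/= => /andP[sx xt].
      by rewrite (le_trans s0 (ltW sx)) (le_trans xt t1).
    rewrite lebesgue_measure_itv/= lte_fin; case: ltP => // ts.
    by rewrite (_ : t = s) ?subrr//; apply/eqP; rewrite eq_le ts st.
  by rewrite poweR_EFin powR12_sqrt ?subr_ge0// distrC ger0_norm ?subr_ge0.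
- by apply: measurable_funB; exact: measurable_Lspace.
- by apply: measurable_funB; exact: measurable_char_fun.
- have tae := Lspace_class_ae (char_fun t : LfunType (@lebesgue01 R) (lee1n 2)).
  have sae := Lspace_class_ae (char_fun s : LfunType (@lebesgue01 R) (lee1n 2)).
  by apply: filterS2 tae sae => x /= <- <-.
Qed.

(** A ball of radius [e] contains at most one point of a [2 * e]-separated
    family, so assigning to each point a ball that contains it is injective. *)
Lemma packing_le_cover (R : realType) (X : metricType R) (e : R) (A : set X)
    (m n : nat) (s : 'I_m -> X) :
  (forall i, A (s i)) -> (forall i j, i != j -> 2 * e < mdist (s i) (s j)) ->
  Defs.covered_by e A n -> (m <= n)%N.
Proof.
move=> As sep [c Ac].
have /choice[f fP] : forall i, exists k, mdist (c k) (s i) <= e.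
  by move=> i; have [k _ ck] := Ac _ (As i); exists k.
suff /leq_card : injective f by rewrite !card_ord.
move=> i j fij; apply/eqP/negP => /negP /sep; apply/negP; rewrite -leNgt.
rewrite (le_trans (metric_triangle _ (c (f i)) _))//.
by rewrite mulr_natl mulr2n lerD//; [rewrite metric_sym | rewrite fij].
Qed.

Lemma char_covered_ge (R : realType) (e : R) (n : nat) : 0 < e ->
  Defs.covered_by e (char_intervals R) n -> 4^-1 * (1 / e) ^+ 2 <= n%:R.
Proof.
move=> e0 cov; rewrite leNgt; apply/negP => nlt.
(* For [n = 0] the family is the single point [0 / 0 = 0]. *)
pose p (i : 'I_n.+1) : R := i%:R / n%:R.
have p01 i : 0 <= p i <= 1.
  rewrite /p divr_ge0//=; have [->|n0] := eqVneq (n%:R : R) 0.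
    by rewrite invr0 mulr0.
  by rewrite ler_pdivrMr ?lt0r ?n0 ?ler0n// mul1r ler_nat -ltnS.
suff : (n.+1 <= n)%N by rewrite ltnn.
apply: (@packing_le_cover R _ e _ _ _ (@char_class R \o p) _ _ cov) => [i|i j ij].
  by exists (p i) => //=; rewrite in_itv/= p01.
have n0 : (0 < n)%N.
  case: n p p01 nlt cov i j ij => // p p01 _ _ i j; rewrite !ord1 eqxx//.
have n0' : 0 < n%:R :> R by rewrite ltr0n.
rewrite /= mdist_char_class// -(ger0_norm (ltW e0)) -sqrtr_sqr.
have pij : n%:R^-1 <= `|p i - p j|.
  rewrite -mulrBl normrM (ger0_norm (_ : 0 <= n%:R^-1)) ?invr_ge0//.
  rewrite ler_peMl ?invr_ge0//.
  have : (i : nat) != j by [].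
  rewrite neq_ltn => /orP[] lt; [rewrite distrC|].
    by rewrite -natrB ?(ltnW lt)// normr_nat ler1n subn_gt0.
  by rewrite -natrB ?(ltnW lt)// normr_nat ler1n subn_gt0.
have e4 : 4 * e ^+ 2 < n%:R^-1.
  rewrite -[ltLHS]invrK ltf_pV2 ?posrE//; last by rewrite invr_gt0 mulr_gt0 ?exprn_gt0.
  by move: nlt; rewrite div1r exprVn -invfM.
rewrite -[ltLHS]ger0_norm ?mulr_ge0 ?sqrtr_ge0// -sqrtr_sqr ltr_sqrt; last first.
  by rewrite (lt_le_trans _ pij) ?invr_gt0.
rewrite (lt_le_trans _ pij)// exprMn sqr_sqrtr ?sqr_ge0//.
by rewrite -natrX.
Qed.

Lemma char_covered (R : realType) (e : R) (n : nat) : 0 < e ->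
  (1 / e) ^+ 2 <= n%:R -> Defs.covered_by e (char_intervals R) n.
Proof.
move=> e0 en.
have n0' : 0 < n%:R :> R by rewrite (lt_le_trans _ en)// exprn_gt0 ?divr_gt0.
have n0 : (0 < n)%N by rewrite -(ltr0n R).
case: n n0 n0' en => // n _ n0 en.
pose p (i : 'I_n.+1) : R := i%:R / n.+1%:R.
have p01 i : 0 <= p i <= 1.
  by rewrite divr_ge0//= ler_pdivrMr// mul1r ler_nat ltnW.
exists (@char_class R \o p) => f [t /=]; rewrite in_itv/= => /andP[t0 t1] <-{f}.
have nt0 : 0 <= n.+1%:R * t by rewrite mulr_ge0.
(* The index is the integer part of [n.+1 * t], except that [t = 1] goes to the
   last interval. *)
have : exists i : 'I_n.+1, i%:R <= n.+1%:R * t <= i%:R + 1.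
  have /andP[lo hi] := truncn_itv nt0.
  have [lt|ge] := ltnP (Num.truncn (n.+1%:R * t)) n.+1.
    by exists (Ordinal lt) => /=; rewrite lo/= natr1 ltW.
  exists ord_max; rewrite /= natr1 ler_piMr// andbT.
  by rewrite (le_trans _ lo)// ler_nat ltnW.
move=> [i /andP[lo hi]]; exists i => //; rewrite /metric_closed_ball/=.
rewrite mdist_char_class//; last by rewrite t0 t1.
rewrite -[leRHS](ger0_norm (ltW e0)) -(sqrtr_sqr e) ler_wsqrtr//.
have -> : p i - t = (i%:R - n.+1%:R * t) / n.+1%:R.
  by rewrite mulrBl mulrAC divff ?mul1r// gt_eqF.
rewrite normrM normfV (ger0_norm (ltW n0)) ler_pdivrMr//.
rewrite (@le_trans _ _ 1)//; first by rewrite ler_norml; apply/andP; split; lra.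
move: en; rewrite div1r exprVn -[X in X <= _]mul1r ler_pdivrMr ?exprn_gt0//.
by rewrite mulrC.
Qed.

Lemma covering_number_char_bounds (R : realType) (e : R) : 0 < e <= 1 ->
  4^-1 * (1 / e) ^+ 2 <= (covering_number e (char_intervals R))%:R
    <= 2 * (1 / e) ^+ 2.
Proof.
move=> /andP[e0 e1].
set x := (1 / e) ^+ 2.
have x1 : 1 <= x by rewrite /x div1r exprVn invf_ge1 ?exprn_gt0// expr_le1// ltW.
have /andP[lo hi] := truncn_itv (le_trans ler01 x1).
have cov : Defs.covered_by e (char_intervals R) (Num.truncn x).+1.
  by apply: char_covered => //; exact: ltW.
have [cn cmin] := covering_numberP (ex_intro _ _ cov).
rewrite char_covered_ge//=.
rewrite (@le_trans _ _ (Num.truncn x).+1%:R)//; first by rewrite ler_nat cmin.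
by rewrite -natr1 mulrDl mul1r lerD.
Qed.

Lemma cvg_log2_div_log2 (R : realType) (f : R -> R) (C1 C2 : R) :
  0 < C1 ->
  (\forall e \near 0^'+, C1 * (1 / e) ^+ 2 <= f e <= C2 * (1 / e) ^+ 2) ->
  log2 (f e) / (2 * log2 (1 / e)) @[e --> 0^'+] --> (1 : R).
Proof.
move=> C10 fC.
have lnV_cvg : (- ln e)^-1 @[e --> (0:R)^'+] --> (0 : R).
  apply/gtr0_cvgV0.
    near=> e; rewrite oppr_gt0 ln_lt0//; apply/andP; split; near: e.
      exact: nbhs_right_gt.
    exact: nbhs_right_lt.
  by apply/cvgNry; exact: lnNy.
have bnd C : 1 + (ln C / 2) * (- ln e)^-1 @[e --> (0:R)^'+] --> (1 : R).
  rewrite [X in _ --> X](_ : _ = 1 + ln C / 2 * 0); last by rewrite mulr0 addr0.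
  exact: cvgD (cvg_cst _) (cvgM (cvg_cst _) lnV_cvg).
apply: (squeeze_cvgr _ (bnd C1) (bnd C2)).
near=> e.
have e0 : 0 < e by near: e; exact: nbhs_right_gt.
have e1 : e < 1 by near: e; exact: nbhs_right_lt.
have /andP[lo hi] : C1 * (1 / e) ^+ 2 <= f e <= C2 * (1 / e) ^+ 2 by near: e.
have x0 : 0 < (1 / e) ^+ 2 by rewrite exprn_gt0 ?divr_gt0.
have f0 : 0 < f e by apply: lt_le_trans lo; exact: mulr_gt0.
have C20 : 0 < C2 by move: (lt_le_trans f0 hi); rewrite pmulr_lgt0.
have L0 : 0 < - ln e by rewrite oppr_gt0 ln_lt0// e0 e1.
have ln2 : 0 < ln 2 :> R by rewrite ln_gt0// ltr1n.
have -> : log2 (f e) / (2 * log2 (1 / e)) = ln (f e) / (2 * - ln e).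
  rewrite /log2 div1r lnV ?posrE//; field.
  by rewrite (gt_eqF ln2) -oppr_eq0 gt_eqF.
(* The bounds are logarithms of [C * (1 / e) ^+ 2] over the common
   denominator. *)
have E C : 1 + ln C / 2 / - ln e = (ln C + 2 * - ln e) / (2 * - ln e).
  by field; rewrite -oppr_eq0 gt_eqF.
have lnE C : 0 < C -> ln C + 2 * - ln e = ln (C * (1 / e) ^+ 2).
  move=> C0; rewrite lnM ?posrE// lnXn ?divr_gt0// div1r lnV ?posrE//.
  by rewrite mulr_natl.
rewrite !E !lnE// !ler_pM2r ?invr_gt0 ?mulr_gt0//.
by rewrite !ler_ln ?posrE ?(mulr_gt0 _ x0)// lo hi.
Unshelve. all: by end_near. Qed.

Theorem proposition2p7 (R : realType) :
  (exists C1 C2 : R, [/\ 0 < C1, 0 < C2 &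
    \forall e \near 0^'+,
      C1 * (1 / e) ^+ 2 <= (covering_number e (char_intervals R))%:R
        <= C2 * (1 / e) ^+ 2]) /\
  (entropy e (char_intervals R) / (2 * log2 (1 / e)) @[e --> 0^'+] --> (1 : R)).
Proof.
have bnd : \forall e \near (0:R)^'+,
    4^-1 * (1 / e) ^+ 2 <= (covering_number e (char_intervals R))%:R
      <= 2 * (1 / e) ^+ 2.
  near=> e; apply: covering_number_char_bounds; apply/andP; split; near: e.
    exact: nbhs_right_gt.
  exact: nbhs_right_le.
split; first by exists 4^-1, 2; split.
by apply: cvg_log2_div_log2 bnd.
Unshelve. all: by end_near. Qed.
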